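(* Let $N,n,m\ge1$. The function $(X,Y)\mapsto\mathrm{GNSA}(X,Y)$ is continuous on the set of pairs $(X,Y)\in(\mathbb{R}^n)^N\times(\mathbb{R}^m)^N$ of point clouds of size $N$ such that neither $X$ nor $Y$ is all zero.
   Context: A point cloud of size $N$ in $\mathbb{R}^n$ is a tuple $X=(x_1,\ldots,x_N)\in(\mathbb{R}^n)^N$, and $(\mathbb{R}^n)^N$ carries its usual topology. $d(\cdot,\cdot)$ is Euclidean distance. For point clouds $X=(x_1,\ldots,x_N)\in(\mathbb{R}^n)^N$ and $Y=(y_1,\ldots,y_N)\in(\mathbb{R}^m)^N$, neither all zero, $$\mathrm{GNSA}(X,Y)=\frac1{N^2}\sum_{1\le i,j\le N}\left|\frac{d(x_i,x_j)}{\max_{1\le l\le N}d(x_l,0)}-\frac{d(y_i,y_j)}{\max_{1\le l\le N}d(y_l,0)}\right|.$$ *)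

(* Defs.v *)
From mathcomp Require Import all_boot all_order all_algebra.
From mathcomp Require Import all_classical all_reals all_analysis.

Set Implicit Arguments.
Unset Strict Implicit.
Unset Printing Implicit Defensive.

Import Order.TTheory GRing.Theory Num.Theory.
Import numFieldNormedType.Exports.

Local Open Scope classical_set_scope.
Local Open Scope ring_scope.

(* A point cloud (x_1, ..., x_N) in (R^n)^N is the matrix X : 'M[R]_(N, n)
   whose l-th row is x_l; the topology of 'M[R]_(N, n) is the entrywise one,
   i.e. the usual topology of (R^n)^N. *)

(* The norm provided by the library on row vectors is the sup norm, so the
   Euclidean distance has to be written out. *)
Definition edist (R : realType) (n : nat) (u v : 'rV[R]_n) : R :=
  Num.sqrt (\sum_(k < n) (u 0 k - v 0 k) ^+ 2).

(* The default value 0 of the iterated maximum is harmless: distances are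
   nonnegative, so for 0 < N this is the maximum over the N points. *)
Definition max_radius (R : realType) (N n : nat) (X : 'M[R]_(N, n)) : R :=
  \big[Num.max/0]_(l < N) edist (row l X) 0.

Definition GNSA (R : realType) (N n m : nat)
    (X : 'M[R]_(N, n)) (Y : 'M[R]_(N, m)) : R :=
  (N%:R ^+ 2)^-1 *
  \sum_(i < N) \sum_(j < N)
    `| edist (row i X) (row j X) / max_radius X
       - edist (row i Y) (row j Y) / max_radius Y |.

Definition not_all_zero (R : realType) (N n : nat) (X : 'M[R]_(N, n)) : Prop :=
  exists l : 'I_N, row l X <> 0.

(* Main.v *)
Require Import Defs.
From mathcomp Require Import all_boot all_order all_algebra.
From mathcomp Require Import all_classical all_reals all_analysis.

Import Order.TTheory GRing.Theory Num.Theory.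
Import numFieldNormedType.Exports.

Local Open Scope classical_set_scope.
Local Open Scope ring_scope.

(** Everything in [GNSA] except division (sums, squares, square roots, finite maxima, absolute
    values) is continuous in the matrix entries. The only possible obstruction is a vanishing
    denominator: [max_radius_neq0] excludes it when a cloud has a nonzero point, and
    [cvg_normalized_dist] then gives the limit of each quotient. *)

(* The qualifier is needed: [edist] alone is the extended distance of the
   library. *)
Lemma cvg_euclidean_dist (R : realType) (n : nat) (T : Type) (F : set_system T)
    (FF : Filter F) (f g : T -> 'rV[R]_n) (u v : 'rV[R]_n) :
  (forall k, f t 0 k @[t --> F] --> u 0 k) ->
  (forall k, g t 0 k @[t --> F] --> v 0 k) ->
  Defs.edist (f t) (g t) @[t --> F] --> Defs.edist u v.
Proof.
move=> fu gv; rewrite /Defs.edist.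
apply: (continuous_cvg _ (@sqrt_continuous R _)).
apply: cvg_big => [|k _]; first exact: add_continuous.
exact: (continuous_cvg _ (@exprn_continuous R 2 _) (cvgB (fu k) (gv k))).
Qed.

Lemma cvg_row_entry (R : realType) (N n : nat) (X : 'M[R]_(N, n)) i k :
  row i M 0 k @[M --> X] --> row i X 0 k.
Proof.
rewrite mxE; under eq_fun do rewrite mxE.
exact: coord_continuous.
Qed.

Lemma continuous_row_dist (R : realType) (N n : nat) (i j : 'I_N) :
  continuous (fun X : 'M[R]_(N, n) => Defs.edist (row i X) (row j X)).
Proof.
move=> X; have FX : Filter (nbhs X) := _.
by apply: cvg_euclidean_dist => k; apply: cvg_row_entry.
Qed.

Lemma continuous_max_radius (R : realType) (N n : nat) :
  continuous (@max_radius R N n).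
Proof.
move=> X; have FX : Filter (nbhs X) := _.
apply: cvg_big => [|l _]; first exact: max_continuous.
by apply: cvg_euclidean_dist => k; [apply: cvg_row_entry | apply: cvg_cst].
Qed.

Lemma euclidean_dist_eq0 (R : realType) (n : nat) (u v : 'rV[R]_n) :
  Defs.edist u v = 0 -> u = v.
Proof.
(* [Num.sqrt] is 0 on negative numbers too, so this yields only that the sum is at most 0;
   nonnegativity of the squares gives equality. *)
move=> /eqP; rewrite sqrtr_eq0 => le0.
have sq_ge0 k : true -> 0 <= (u 0 k - v 0 k) ^+ 2 by rewrite sqr_ge0.
have /(psumr_eq0P sq_ge0) eq0 : \sum_(k < n) (u 0 k - v 0 k) ^+ 2 = 0.
  by apply/eqP; rewrite eq_le le0 sumr_ge0.
by apply/rowP => k; apply/eqP; rewrite -subr_eq0 -sqrf_eq0 eq0.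
Qed.

(** If the maximum were 0, it would bound each distance to the origin by 0, forcing every row to
    vanish. *)
Lemma max_radius_neq0 (R : realType) (N n : nat) (X : 'M[R]_(N, n)) :
  not_all_zero X -> max_radius X != 0.
Proof.
case=> l Xl; apply: contra_notN Xl => /eqP r0; apply: euclidean_dist_eq0.
apply/eqP; rewrite eq_le sqrtr_ge0 andbT -r0.
exact: (le_bigmax 0 (fun l => Defs.edist (row l X) 0)).
Qed.

Lemma cvg_normalized_dist (R : realType) (N n : nat) (X : 'M[R]_(N, n)) i j :
  not_all_zero X ->
  Defs.edist (row i M) (row j M) / max_radius M @[M --> X] -->
  Defs.edist (row i X) (row j X) / max_radius X.
Proof.
move=> /max_radius_neq0 X0; have FX : Filter (nbhs X) := _.
apply: cvgM; first exact: continuous_row_dist.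
by apply: cvgV => //; apply: continuous_max_radius.
Qed.

Theorem mainTheorem9 (R : realType) (N n m : nat)
    (hN : (1 <= N)%N) (hn : (1 <= n)%N) (hm : (1 <= m)%N) :
  {within [set XY : 'M[R]_(N, n) * 'M[R]_(N, m) |
             not_all_zero XY.1 /\ not_all_zero XY.2],
    continuous (fun XY : 'M[R]_(N, n) * 'M[R]_(N, m) => GNSA XY.1 XY.2)}.
Proof.
(* It suffices that the function on the whole product space is continuous at each point of the
   set. *)
apply: continuous_in_subspaceT => -[X Y] /set_mem[/= X0 Y0].
have FXY : Filter (nbhs (X, Y)) := _.
apply: cvgM; first exact: cvg_cst.
apply: cvg_big => [|i _]; first exact: add_continuous.
apply: cvg_big => [|j _]; first exact: add_continuous.
apply: cvg_norm; apply: cvgB.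
(* Each quotient involves one cloud only, hence factors through a projection. *)
- exact: (cvg_comp _ _ cvg_fst (cvg_normalized_dist _ _ _ _ i j X0)).
- exact: (cvg_comp _ _ cvg_snd (cvg_normalized_dist _ _ _ _ i j Y0)).
Qed.
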